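(* Let $(X,(\cdot,\cdot|\cdot))$ be a $2$-inner product space over $\mathbb{K}$ ($\mathbb{K}=\mathbb{R}$ or $\mathbb{C}$), let $x,y,z\in X$ and $a,A\in\mathbb{K}$. The conditions $$\operatorname{Re}\,(Ay-x,\,x-ay\,|\,z)\ge 0 \qquad\text{and}\qquad \left\Vert x-\tfrac{a+A}{2}\,y\,\middle|\,z\right\Vert\le \tfrac12|A-a|\,\Vert y|z\Vert$$ are equivalent, and if they hold, then $$0\le \Vert x|z\Vert^2\Vert y|z\Vert^2-|(x,y|z)|^2\le \frac14|A-a|^2\Vert y|z\Vert^4-\left|\frac{a+A}{2}\Vert y|z\Vert^2-(x,y|z)\right|^2\ \left(\le \frac14|A-a|^2\Vert y|z\Vert^4\right).$$ The constant $\frac14$ in the second inequality is sharp in the sense that it cannot be replaced by a smaller constant: for every real $C<\frac14$ there exist a $2$-inner product space over $\mathbb{K}$, vectors $x,y,z$ in it and scalars $a,A\in\mathbb{K}$ satisfying $\operatorname{Re}\,(Ay-x,\,x-ay\,|\,z)\ge 0$ (equivalently, $\left\Vert x-\tfrac{a+A}{2}\,y\,\middle|\,z\right\Vert\le \tfrac12|A-a|\,\Vert y|z\Vert$) for which $$\Vert x|z\Vert^2\Vert y|z\Vert^2-|(x,y|z)|^2> C|A-a|^2\Vert y|z\Vert^4-\left|\frac{a+A}{2}\Vert y|z\Vert^2-(x,y|z)\right|^2 .$$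
   Context: Let $X$ be a linear space of dimension greater than $1$ over $\mathbb{K}$, where $\mathbb{K}=\mathbb{R}$ or $\mathbb{K}=\mathbb{C}$. A $2$-inner product on $X$ is a function $(\cdot,\cdot|\cdot):X\times X\times X\to\mathbb{K}$ such that for all $x,x',y,z\in X$ and $\alpha\in\mathbb{K}$: (1) $(x,x|z)\ge 0$, and $(x,x|z)=0$ if and only if $x$ and $z$ are linearly dependent; (2) $(x,x|z)=(z,z|x)$; (3) $(y,x|z)=\overline{(x,y|z)}$; (4) $(\alpha x,y|z)=\alpha(x,y|z)$; (5) $(x+x',y|z)=(x,y|z)+(x',y|z)$. Then $(X,(\cdot,\cdot|\cdot))$ is called a $2$-inner product space. The associated $2$-norm is $\Vert x|z\Vert=\sqrt{(x,x|z)}$. *)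

(* Defs.v *)
From mathcomp Require Import all_boot all_order all_algebra.
From mathcomp Require Import reals complex.

Set Implicit Arguments.
Unset Strict Implicit.
Unset Printing Implicit Defensive.

Import Order.TTheory GRing.Theory Num.Theory.
Local Open Scope ring_scope.

(* The two possible scalar fields, over an arbitrary model R of the reals. *)
Inductive scalar_kind := RealScalars | ComplexScalars.

Definition scal (R : realType) (k : scalar_kind) : numFieldType :=
  match k with
  | RealScalars => R
  | ComplexScalars => R[i]
  end.

Definition conjK (R : realType) (k : scalar_kind) : scal R k -> scal R k :=
  match k return scal R k -> scal R k with
  | RealScalars => fun c => c
  | ComplexScalars => fun c => conjc c
  end.

Definition ReK (R : realType) (k : scalar_kind) : scal R k -> R :=
  match k return scal R k -> R with
  | RealScalars => fun c => c
  | ComplexScalars => fun c => complex.Re c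
  end.

Definition ofRealK (R : realType) (k : scalar_kind) : R -> scal R k :=
  match k return R -> scal R k with
  | RealScalars => fun r => r
  | ComplexScalars => fun r => r%:C%C
  end.

(* The norm of R[i] takes its values in R[i], on the nonnegative real axis;
   ReK reads it back as an element of R. *)
Definition modK (R : realType) (k : scalar_kind) (c : scal R k) : R :=
  ReK `|c|.

Definition lindep (K : numFieldType) (X : lmodType K) (x z : X) : Prop :=
  exists s t : K, (s != 0 \/ t != 0) /\ s *: x + t *: z = 0.

(* [ip x y z] is (x, y | z). In [tip_ge0] the order is that of the scalar field:
   over R[i], 0 <= c says that c is real and nonnegative. *)
Record is_two_inner_product (R : realType) (k : scalar_kind)
    (X : lmodType (scal R k)) (ip : X -> X -> X -> scal R k) : Prop :=
  IsTwoInnerProduct {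
    tip_ge0 : forall x z, 0 <= ip x x z;
    tip_eq0 : forall x z, ip x x z = 0 <-> lindep x z;
    tip_swap : forall x z, ip x x z = ip z z x;
    tip_conj : forall x y z, ip y x z = conjK (ip x y z);
    tip_scale : forall (c : scal R k) x y z, ip (c *: x) y z = c * ip x y z;
    tip_add : forall x x' y z, ip (x + x') y z = ip x y z + ip x' y z
  }.

(* The field [two_dim_gt1] says that the dimension, possibly infinite, is
   greater than 1. *)
Record two_inner_space (R : realType) (k : scalar_kind) := TwoInnerSpace {
  two_carrier :> lmodType (scal R k);
  two_dim_gt1 : exists u v : two_carrier, ~ lindep u v;
  two_ip : two_carrier -> two_carrier -> two_carrier -> scal R k;
  two_ipP : is_two_inner_product two_ip
}.

Definition two_norm (R : realType) (k : scalar_kind) (X : two_inner_space R k)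
    (x z : X) : R :=
  Num.sqrt (ReK (two_ip x x z)).

(* Main.v *)
(* Write m = (a + A) / 2. Expanding around the midpoint gives
     Re (A y - x, x - a y | z) = |A - a|^2 / 4 * ||y|z||^2 - ||x - m y|z||^2,
   which is the equivalence, and
     ||y|z||^2 ||x - m y|z||^2
       = ||x|z||^2 ||y|z||^2 - |(x,y|z)|^2 + |m ||y|z||^2 - (x,y|z)|^2
   then turns the norm condition multiplied by ||y|z||^2 into the upper bound,
   so the bound is an equality as soon as the norm condition is one. Hence any
   such configuration with A <> a and ||y|z|| <> 0 shows sharpness: on K^2 with
   (x,y|z) = det(x,z) conj(det(y,z)), take x = y = e1, z = e2, a = 0, A = 1. *)

Require Import Defs.
From HB Require Import structures.
From mathcomp Require Import all_boot all_order all_algebra.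
From mathcomp Require Import reals complex.
From mathcomp Require Import ring.

Set Implicit Arguments.
Unset Strict Implicit.
Unset Printing Implicit Defensive.

Import Order.TTheory GRing.Theory Num.Theory.
Local Open Scope ring_scope.

(** * Conjugation, real part and modulus, treated uniformly over both scalar fields *)

Section Scalars.
Variables (R : realType) (k : scalar_kind).
Implicit Types (c : scal R k) (r : R).

Lemma conjK_zmod_morphism : zmod_morphism (@conjK R k).
Proof. case: k => // c d; exact: (rmorphB (@conjc R)). Qed.

Lemma conjK_monoid_morphism : monoid_morphism (@conjK R k).
Proof.
case: k => //; split; first exact: (rmorph1 (@conjc R)).
exact: (rmorphM (@conjc R)).
Qed.

HB.instance Definition _ :=
  GRing.isZmodMorphism.Build _ _ (@conjK R k) conjK_zmod_morphism.
HB.instance Definition _ :=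
  GRing.isMonoidMorphism.Build _ _ (@conjK R k) conjK_monoid_morphism.

Lemma ofRealK_zmod_morphism : zmod_morphism (@ofRealK R k).
Proof. case: k => // c d; exact: (rmorphB (@real_complex R)). Qed.

Lemma ofRealK_monoid_morphism : monoid_morphism (@ofRealK R k).
Proof.
case: k => //; split; first exact: (rmorph1 (@real_complex R)).
exact: (rmorphM (@real_complex R)).
Qed.

HB.instance Definition _ :=
  GRing.isZmodMorphism.Build _ _ (@ofRealK R k) ofRealK_zmod_morphism.
HB.instance Definition _ :=
  GRing.isMonoidMorphism.Build _ _ (@ofRealK R k) ofRealK_monoid_morphism.

Lemma conjKK : involutive (@conjK R k).
Proof. by case: k => //= c; rewrite conjcK. Qed.

Lemma ofRealKK : cancel (@ofRealK R k) (@ReK R k).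
Proof. by case: k. Qed.

(** The route for the real identities below: after embedding into the scalar field, [mul_conjK],
    [add_conjK] and [two_norm_sqr] remove moduli, real parts and norms, leaving an identity for
    [ring] or [field]. *)
Lemma ofRealK_inj : injective (@ofRealK R k).
Proof. exact: can_inj ofRealKK. Qed.

Lemma conjK_ofReal r : conjK (ofRealK k r) = ofRealK k r.
Proof. by case: k => //; exact: conjc_real. Qed.

Lemma ReK_ge0 c : 0 <= c -> 0 <= ReK c.
Proof. by case: k c => //= -[u v]; rewrite lecE /= => /andP[]. Qed.

Lemma ofRealK_ReK c : 0 <= c -> ofRealK k (ReK c) = c.
Proof. by case: k c => //= -[u v]; rewrite lecE /= => /andP[/eqP-> _]. Qed.

Lemma modK_ge0 c : 0 <= modK c.
Proof. by apply: ReK_ge0; rewrite normr_ge0. Qed.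

Lemma mul_conjK_norm c : c * conjK c = `|c| ^+ 2.
Proof.
case: k c => c; last by rewrite sqr_normc.
by rewrite real_normK ?num_real.
Qed.

Lemma mul_conjK c : c * conjK c = ofRealK k (modK c ^+ 2).
Proof. by rewrite mul_conjK_norm rmorphXn /= ofRealK_ReK. Qed.

Lemma add_conjK c : ofRealK k (2 * ReK c) = c + conjK c.
Proof.
case: k c => [|] /= c; first by rewrite mulr_natl mulr2n.
case: c => u v; apply/eqP; rewrite eq_complex /=.
by apply/andP; split; apply/eqP; ring.
Qed.

End Scalars.

(** * Expansion identities and the Cauchy-Schwarz inequality *)

Section TwoInnerProduct.
Variables (R : realType) (k : scalar_kind) (X : two_inner_space R k).
Implicit Types (x y z : X) (a A c m : scal R k).

Lemma two_ip_addr x y y' z : two_ip x (y + y') z = two_ip x y z + two_ip x y' z.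
Proof.
by rewrite !(tip_conj (two_ipP X) _ x) (tip_add (two_ipP X)) rmorphD.
Qed.

Lemma two_ip_scaler c x y z : two_ip x (c *: y) z = conjK c * two_ip x y z.
Proof.
by rewrite !(tip_conj (two_ipP X) _ x) (tip_scale (two_ipP X)) rmorphM.
Qed.

Definition two_ipE := (tip_add (two_ipP X), tip_scale (two_ipP X),
  two_ip_addr, two_ip_scaler).

Lemma two_norm_sqr x z : ofRealK k (two_norm x z ^+ 2) = two_ip x x z.
Proof.
have xz_ge0 := tip_ge0 (two_ipP X) x z.
by rewrite sqr_sqrtr ?ReK_ge0 // ofRealK_ReK.
Qed.

Lemma two_norm_subZ m x y z :
  two_norm (x - m *: y) z ^+ 2 =
  two_norm x z ^+ 2 - 2 * ReK (two_ip x y z * conjK m)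
    + modK m ^+ 2 * two_norm y z ^+ 2.
Proof.
apply: (@ofRealK_inj R k); rewrite rmorphD rmorphB (rmorphM _ (modK m ^+ 2)) /=.
rewrite add_conjK -mul_conjK !two_norm_sqr -scaleNr !two_ipE (tip_conj (two_ipP X) x y).
rewrite rmorphN rmorphM /= conjKK; ring.
Qed.

Lemma ReK_two_ip_sub a A x y z :
  ReK (two_ip (A *: y - x) (x - a *: y) z) =
  1 / 4 * modK (A - a) ^+ 2 * two_norm y z ^+ 2
    - two_norm (x - ((a + A) / 2) *: y) z ^+ 2.
Proof.
(* Doubling makes [add_conjK] applicable to the real part. *)
apply: (@mulfI _ 2); first by rewrite pnatr_eq0.
apply: (@ofRealK_inj R k); rewrite add_conjK.
have -> : 2 * (1 / 4 * modK (A - a) ^+ 2 * two_norm y z ^+ 2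
    - two_norm (x - ((a + A) / 2) *: y) z ^+ 2) =
  1 / 2 * (modK (A - a) ^+ 2 * two_norm y z ^+ 2)
    - 2 * two_norm (x - ((a + A) / 2) *: y) z ^+ 2 by field.
rewrite rmorphB (rmorphM _ (1 / 2)) (rmorphM _ (modK _ ^+ 2)) (rmorphM _ 2) /=.
rewrite -mul_conjK !two_norm_sqr.
rewrite -!scaleNr -scaleN1r !two_ipE (tip_conj (two_ipP X) x y).
(* Back to embedded reals, so that [conjK_ofReal] shows the diagonal values to be fixed by
   conjugation. *)
rewrite -!two_norm_sqr.
rewrite !(rmorphN, rmorph1, rmorphB, rmorphM, rmorphD) /= !conjKK !conjK_ofReal.
by field.
Qed.

Lemma two_norm_subZ_mul m x y z :
  two_norm y z ^+ 2 * two_norm (x - m *: y) z ^+ 2 =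
  two_norm x z ^+ 2 * two_norm y z ^+ 2 - modK (two_ip x y z) ^+ 2
    + modK (m * ofRealK k (two_norm y z ^+ 2) - two_ip x y z) ^+ 2.
Proof.
suff -> : modK (m * ofRealK k (two_norm y z ^+ 2) - two_ip x y z) ^+ 2 =
    modK m ^+ 2 * two_norm y z ^+ 4
    - 2 * ReK (two_ip x y z * conjK m) * two_norm y z ^+ 2
    + modK (two_ip x y z) ^+ 2 by rewrite two_norm_subZ; ring.
apply: (@ofRealK_inj R k).
rewrite rmorphD rmorphB (rmorphM _ (modK m ^+ 2)) (rmorphM _ (2 * _)) /= add_conjK.
rewrite -!mul_conjK (exprM _ 2 2) rmorphXn.
rewrite rmorphB !rmorphM /= conjK_ofReal conjKK; ring.
Qed.

(** With c = (x,y|z), the squared norm of x - t c y is a real quadratic in t and is nonnegative. If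
    P > 0, take its minimiser t = 1/P and multiply by P. If P = 0, it is affine in t with slope
    -2|c|^2, which forces c = 0. *)
Lemma two_ip_CauchySchwarz x y z :
  modK (two_ip x y z) ^+ 2 <= two_norm x z ^+ 2 * two_norm y z ^+ 2.
Proof.
set c := two_ip x y z; set Q := two_norm x z ^+ 2; set P := two_norm y z ^+ 2.
have quadratic_ge0 (t : R) :
    0 <= Q - 2 * t * modK c ^+ 2 + t ^+ 2 * modK c ^+ 2 * P.
  suff <- : two_norm (x - (ofRealK k t * c) *: y) z ^+ 2 =
    Q - 2 * t * modK c ^+ 2 + t ^+ 2 * modK c ^+ 2 * P by rewrite sqr_ge0.
  have modK_tc : modK (ofRealK k t * c) ^+ 2 = t ^+ 2 * modK c ^+ 2.
    apply: (@ofRealK_inj R k).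
    rewrite -mul_conjK rmorphM /= conjK_ofReal (rmorphM _ (t ^+ 2)) rmorphXn /=.
    rewrite -mul_conjK; ring.
  rewrite two_norm_subZ modK_tc rmorphM /= conjK_ofReal mulrCA mul_conjK.
  by rewrite -rmorphM ofRealKK mulrA.
have [P_gt0|P_le0] := ltP 0 P.
  have := quadratic_ge0 P^-1; rewrite -(pmulr_rge0 _ P_gt0).
  have -> : P * (Q - 2 * P^-1 * modK c ^+ 2 + P^-1 ^+ 2 * modK c ^+ 2 * P) =
    Q * P - modK c ^+ 2 by field; rewrite gt_eqF.
  by rewrite subr_ge0.
have P0 : P = 0 by apply/eqP; rewrite eq_le P_le0 sqr_ge0.
move: (modK c ^+ 2) quadratic_ge0 => e quadratic_ge0.
rewrite P0 mulr0 leNgt; apply/negP => e_gt0.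
(* This t solves Q - 2 t e = -1. *)
have := quadratic_ge0 ((Q + 1) / (2 * e)).
have -> : Q - 2 * ((Q + 1) / (2 * e)) * e
   + ((Q + 1) / (2 * e)) ^+ 2 * e * P = -1.
  by rewrite P0; field; rewrite gt_eqF.
by rewrite ler0N1.
Qed.

End TwoInnerProduct.

(** * The determinant model on K^2 *)

Section CoordinatePlane.
Variables (R : realType) (k : scalar_kind).
Let K := scal R k.
Let V : lmodType K := (K^o * K^o)%type.
Implicit Types x y z : V.

Definition det2 x z : K := x.1 * z.2 - x.2 * z.1.
(** By the Cauchy-Binet identity this is the standard 2-inner product <x,y><z,z> - <x,z><z,y> of
    K^2. *)
Definition det2_ip x y z : K := det2 x z * conjK (det2 y z).

Lemma det2_eq0 x z : det2 x z = 0 <-> lindep x z.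
Proof.
split=> [det0|[s [t [st0 eq0]]]].
- have comb (s t : K) : s != 0 \/ t != 0 ->
      s * x.1 + t * z.1 = 0 -> s * x.2 + t * z.2 = 0 -> lindep x z.
    move=> st0 e1 e2; exists s, t; split=> //.
    by apply/eqP; rewrite xpair_eqE; apply/andP; split; apply/eqP.
  (* A nonzero coordinate x.i gives the coefficients -z.i and x.i: coordinate i cancels by
     commutativity and the other one is the determinant up to sign. If x = 0, use 1 and 0. *)
  have [/eqP x1|x1] := boolP (x.1 == 0); last first.
    apply: (comb (- z.1) x.1); first (by right); last rewrite -det0 /det2; ring.
  have [/eqP x2|x2] := boolP (x.2 == 0); last first.
    apply: (comb (- z.2) x.2); first (by right); first rewrite -oppr0 -det0 /det2; ring.
  by apply: (comb 1 0); rewrite ?x1 ?x2 ?oner_neq0; [left|ring|ring].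
- have eq1 : s * x.1 + t * z.1 = 0 by exact: (congr1 fst eq0).
  have eq2 : s * x.2 + t * z.2 = 0 by exact: (congr1 snd eq0).
  (* Cramer's rule: s and t times the determinant are both combinations of the vanishing coordinates
     of s x + t z. *)
  case: st0 => n0; apply: (mulfI n0); rewrite mulr0 /det2.
    have -> : s * (x.1 * z.2 - x.2 * z.1) =
      (s * x.1 + t * z.1) * z.2 - (s * x.2 + t * z.2) * z.1 by ring.
    by rewrite eq1 eq2 !mul0r subr0.
  have -> : t * (x.1 * z.2 - x.2 * z.1) =
      x.1 * (s * x.2 + t * z.2) - x.2 * (s * x.1 + t * z.1) by ring.
  by rewrite eq1 eq2 !mulr0 subr0.
Qed.

Lemma det2_ipP : is_two_inner_product det2_ip.
Proof.
split=> [x z|x z|x z|x y z|c x y z|x x' y z]; rewrite /det2_ip.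
- by rewrite mul_conjK_norm exprn_ge0.
- rewrite -det2_eq0 mul_conjK_norm; split=> [/eqP|->]; last by rewrite normr0 expr0n.
  by rewrite sqrf_eq0 normr_eq0 => /eqP.
- have -> : det2 z x = - det2 x z by rewrite /det2; ring.
  by rewrite rmorphN mulrNN.
- by rewrite rmorphM /= conjKK mulrC.
- have -> : det2 (c *: x) z = c * det2 x z by rewrite /det2 mulrBr !mulrA.
  by rewrite mulrA.
- have -> : det2 (x + x') z = det2 x z + det2 x' z by rewrite /det2 /=; ring.
  by rewrite mulrDl.
Qed.

Lemma plane_dim_gt1 : exists u v : V, ~ lindep u v.
Proof.
exists (1, 0), (0, 1); rewrite -det2_eq0 /det2 /= mulr1 mulr0 subr0.
exact/eqP/oner_neq0.
Qed.

Definition coordinate_plane : two_inner_space R k :=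
  TwoInnerSpace plane_dim_gt1 det2_ipP.

End CoordinatePlane.

Theorem theorem1 (R : realType) (k : scalar_kind) :
  (forall (X : two_inner_space R k) (x y z : X) (a A : scal R k),
     (0 <= ReK (two_ip (A *: y - x) (x - a *: y) z)
      <-> two_norm (x - ((a + A) / 2) *: y) z
            <= 1 / 2 * modK (A - a) * two_norm y z)
     /\
     (0 <= ReK (two_ip (A *: y - x) (x - a *: y) z) ->
      [/\ 0 <= two_norm x z ^+ 2 * two_norm y z ^+ 2 - modK (two_ip x y z) ^+ 2,
          two_norm x z ^+ 2 * two_norm y z ^+ 2 - modK (two_ip x y z) ^+ 2
            <= 1 / 4 * modK (A - a) ^+ 2 * two_norm y z ^+ 4
               - modK ((a + A) / 2 * ofRealK k (two_norm y z ^+ 2) - two_ip x y z) ^+ 2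
        & 1 / 4 * modK (A - a) ^+ 2 * two_norm y z ^+ 4
            - modK ((a + A) / 2 * ofRealK k (two_norm y z ^+ 2) - two_ip x y z) ^+ 2
            <= 1 / 4 * modK (A - a) ^+ 2 * two_norm y z ^+ 4]))
  /\
  (forall C : R, C < 1 / 4 ->
     exists (X : two_inner_space R k) (x y z : X) (a A : scal R k),
       0 <= ReK (two_ip (A *: y - x) (x - a *: y) z) /\
       C * modK (A - a) ^+ 2 * two_norm y z ^+ 4
         - modK ((a + A) / 2 * ofRealK k (two_norm y z ^+ 2) - two_ip x y z) ^+ 2
       < two_norm x z ^+ 2 * two_norm y z ^+ 2 - modK (two_ip x y z) ^+ 2).
Proof.
split=> [X x y z a A|C C_lt].
  have sqrE : 1 / 4 * modK (A - a) ^+ 2 * two_norm y z ^+ 2 =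
    (1 / 2 * modK (A - a) * two_norm y z) ^+ 2 by field.
  split=> [|cond].
    (* The real part is the difference of the squares of the two sides of the norm condition, both
       nonnegative. *)
    rewrite ReK_two_ip_sub subr_ge0 sqrE ler_sqr ?nnegrE ?sqrtr_ge0 //.
    by rewrite !mulr_ge0 ?sqrtr_ge0 ?modK_ge0 ?invr_ge0.
  split; first by rewrite subr_ge0 two_ip_CauchySchwarz.
    rewrite lerBrDr -two_norm_subZ_mul (exprD _ 2 2) [leRHS]mulrA [leRHS]mulrC.
    by rewrite ler_wpM2l ?sqr_ge0 // -subr_ge0 -ReK_two_ip_sub.
  by rewrite gerBl sqr_ge0.
pose e1 : coordinate_plane R k := (1, 0).
pose e2 : coordinate_plane R k := (0, 1).
have ip11 : two_ip e1 e1 e2 = 1.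
  by rewrite /= /det2_ip /det2 /= !mulr1 mulr0 subr0 rmorph1 mulr1.
have norm1 : two_norm e1 e2 ^+ 2 = 1.
  by apply: (@ofRealK_inj R k); rewrite two_norm_sqr ip11 rmorph1.
have mod1 : modK (1 : scal R k) ^+ 2 = 1.
  by apply: (@ofRealK_inj R k); rewrite -mul_conjK !rmorph1 mulr1.
exists (coordinate_plane R k), e1, e1, e2, 0, 1; split.
  apply: ReK_ge0.
  (* Here A y - x = 0, rewritten as 0 times [e1] so that homogeneity applies. *)
  by rewrite scale1r subrr -[X in two_ip X](scale0r e1) (tip_scale (two_ipP _)) mul0r.
(* The subtracted square at the witness; the claim then reads C - 1/4 < 0. *)
have mod_half : modK (1 / 2 * 1 - 1 : scal R k) ^+ 2 = 1 / 4.
  apply: (@ofRealK_inj R k); by rewrite -mul_conjK; field.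
rewrite subr0 add0r ip11 mod1 (exprM _ 2 2) norm1 rmorph1 mod_half.
by rewrite expr1n !mulr1 subrr subr_lt0.
Qed.
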